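(* Let $X_1,\dots,X_n\in\mathrm{SO}(N)$ be samples from a density $w$, let $q$ be a density on $\mathrm{SO}(N)$, and let $p_\theta(X)\propto\exp(\theta^\top\zeta(X)+\eta(X))$, $\theta\in\mathbb{R}^m$, be an exponential family on $\mathrm{SO}(N)$ with $\zeta:\mathrm{SO}(N)\to\mathbb{R}^m$ and $\eta:\mathrm{SO}(N)\to\mathbb{R}$ continuously differentiable. Take the kernel $k(X,Y)=\exp(\tau\,\mathrm{tr}(X^\top Y))$ with $\tau>0$. Put $\rho_{ij}:=e^{\tau\,\mathrm{tr}(X_i^\top X_j)}\frac{q(X_i)}{w(X_i)}\frac{q(X_j)}{w(X_j)}$ and $M_{ij}:=I\otimes X_iX_j^\top-(X_j^\top\otimes X_i)S_{N,N}$. Define the $m\times m$ matrix $$A=\frac1{2n^2}\sum_{i,j}\mathcal{Z}(X_i)\,M_{ij}\,\mathcal{Z}(X_j)^\top\rho_{ij}$$ and the vector $b\in\mathbb{R}^m$ by $$b^\top=\frac1{2n^2}\sum_{i,j}\mathrm{vec}(\nabla_{X_i}\eta(X_i))^\top M_{ij}\,\mathcal{Z}(X_j)^\top\rho_{ij}+\frac{\tau}{n^2}\sum_{i,j}\mathrm{vec}\big(X_i\mathscr{A}(X_j^\top X_i)\big)^\top\mathcal{Z}(X_i)^\top\rho_{ij}.$$ If $A$ is invertible, then the global minimizer over $\theta\in\mathbb{R}^m$ of the weighted KSD $\mathrm{wKSD}_n^2(\theta)$ is $$\hat\theta_n=-A^{-1}b.$$ In the unweighted case (samples from $q$, ratios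 $q/w$ omitted in $\mathrm{wKSD}_n^2$), the same holds with the factor $\frac{q(X_i)q(X_j)}{w(X_i)w(X_j)}$ omitted.
   Context: $\mathrm{SO}(N)=\{R\in\mathbb{R}^{N\times N}:R^\top R=I,\det R=1\}$; densities are with respect to Haar measure, and $w>0$. Notation: $\mathscr{A}(B)=(B-B^\top)/2$; $\mathrm{vec}$ stacks columns; $\otimes$ is the Kronecker product; $I$ is the $N\times N$ identity; $S_{N,N}$ is the $N^2\times N^2$ perfect shuffle matrix, with $(S_{N,N})_{ab}=1$ whenever $a=Nk+l-N$, $b=Nl+k-N$ for some $1\le k,l\le N$, and $0$ otherwise. The Euclidean gradient $\nabla_Xf\in\mathbb{R}^{N\times N}$ of a differentiable $f$ on $\mathrm{SO}(N)$ is an $N\times N$ matrix such that $Df(X)=\mathrm{tr}[D^\top\nabla_Xf]$ for all $D\in T_X\mathrm{SO}(N)$. Writing $\zeta=(\zeta_1,\dots,\zeta_m)^\top$, $\mathcal{Z}(X)\in\mathbb{R}^{m\times N^2}$ is the matrix whose $i$-th row is $\mathrm{vec}(\nabla_X\zeta_i(X))^\top$. For $1\le i<j\le N$ let $E_{ij}$ be the matrix with $\sqrt2/2$ at entry $(i,j)$, $-\sqrt2/2$ at entry $(j,i)$ and zeros elsewhere; $X\mapsto XE_{ij}$ is a left-invariant vector field $D^{ij}$ on $\mathrm{SO}(N)$, and these form the left-invariant basis used. For a density $p$ put $\mathcal{A}_p^{ij}h:=D^{ij}h+h\,D^{ij}\log p$ and $$k_p(X,Y):=\sum_{i<j}\tilde{\mathcal{A}}_p^{ij}\mathcal{A}_p^{ij}k(X,Y),$$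 where $\mathcal{A}_p^{ij}$ acts on the first argument and $\tilde{\mathcal{A}}_p^{ij}$ is the same operator acting on the second argument. The weighted (discrete) kernel Stein discrepancy is $$\mathrm{wKSD}_n^2(\theta):=\frac1{n^2}\sum_{i,j=1}^nk_{p_\theta}(X_i,X_j)\,q(X_i)q(X_j)\,w(X_i)^{-1}w(X_j)^{-1}.$$ *)

(* Defs.v *)
From HB Require Import structures.
From mathcomp Require Import all_boot all_order all_algebra.
From mathcomp Require Import all_classical all_reals all_analysis.
From mathcomp Require Export mxtens.

Set Implicit Arguments.
Unset Strict Implicit.
Unset Printing Implicit Defensive.

Import Order.TTheory GRing.Theory Num.Theory numFieldNormedType.Exports.

Local Open Scope classical_set_scope.
Local Open Scope ring_scope.

Definition SO_set (R : realType) (N : nat) : set 'M[R]_N :=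
  [set X | X^T *m X = 1%:M /\ \det X = 1].
Arguments SO_set : clear implicits.

Definition SO (R : realType) (N : nat) : Type := set_type (SO_set R N).

Lemma SO_set1 (R : realType) (N : nat) : SO_set R N 1%:M.
Proof. by split; rewrite ?trmx1 ?mulmx1 ?det1. Qed.

(* The subspace topology of SO(N) inside the N x N matrices, and its Borel
   sigma-algebra. *)
HB.instance Definition _ (R : realType) (N : nat) :=
  Topological.copy (SO R N) (set_type (SO_set R N)).
HB.instance Definition _ (R : realType) (N : nat) :=
  isPointed.Build (SO R N) (SigSub (mem_set (SO_set1 R N))).
HB.instance Definition _ (R : realType) (N : nat) :=
  Measurable.copy (SO R N) (g_sigma_algebraType (@open (SO R N))).

Definition SO_mx (R : realType) (N : nat) (X : SO R N) : 'M[R]_N := set_val X.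
Coercion SO_mx : SO >-> matrix.

(* Haar measure, normalized to have total mass one. *)
Definition is_haar (R : realType) (N : nat) (mu : probability (SO R N) R) :=
  forall (g : SO R N) (B : set (SO R N)), measurable B ->
    mu [set y | exists2 x : SO R N, B x & SO_mx y = g *m x] = mu B.

Definition is_density (R : realType) (N : nat) (mu : probability (SO R N) R)
    (f : SO R N -> R) :=
  [/\ measurable_fun setT f, (forall x, 0 <= f x) &
      (\int[mu]_x (f x)%:E = 1)%E].

(* Every X_i has density f; nothing is assumed on their joint distribution. *)
Definition samples_from (R : realType) (N : nat) (mu : probability (SO R N) R)
    (f : SO R N -> R) (d : measure_display) (T : measurableType d)
    (P : probability T R) (n : nat) (X : 'I_n -> {RV P >-> SO R N}) :=
  forall (i : 'I_n) (B : set (SO R N)), measurable B ->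
    distribution P (X i) B = (\int[mu]_(x in B) (f x)%:E)%E.

Definition tangent (R : realType) (N : nat) (X : SO R N) : set 'M[R]_N :=
  [set X *m B | B in [set B : 'M[R]_N | B^T = - B]].

Definition curve_through (R : realType) (N : nat) (X : SO R N) (D : 'M[R]_N)
    (g : R -> SO R N) :=
  g 0 = X /\ is_derive (0 : R) (1 : R) (fun t : R => SO_mx (g t)) D.

(* Df(X) = l in the tangent direction D: the derivative of f along every curve
   in SO(N) which passes through X with velocity D. *)
Definition has_derivative (R : realType) (N : nat) (f : SO R N -> R)
    (X : SO R N) (D : 'M[R]_N) (l : R) :=
  forall g : R -> SO R N, curve_through X D g ->
    is_derive (0 : R) (1 : R) (fun t : R => f (g t)) l.

(* The Euclidean gradient is determined only up to a matrix normal to the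
   tangent space, whence a relation rather than a function. *)
Definition is_gradient (R : realType) (N : nat) (f : SO R N -> R)
    (X : SO R N) (G : 'M[R]_N) :=
  forall D : 'M[R]_N, tangent X D -> has_derivative f X D (\tr (D^T *m G)).

Definition continuously_differentiable (R : realType) (N : nat)
    (f : SO R N -> R) :=
  exists2 G : SO R N -> 'M[R]_N, (forall X, is_gradient f X (G X)) &
    continuous G.

Definition Emx (R : realType) (N : nat) (i j : 'I_N) : 'M[R]_N :=
  (Num.sqrt 2 / 2) *: (delta_mx i j - delta_mx j i).

(* The left-invariant vector field X |-> X E_ij acting on functions (0 where f
   has no derivative in that direction). *)
Definition Dfield (R : realType) (N : nat) (i j : 'I_N) (f : SO R N -> R)
    (X : SO R N) : R :=
  xget 0 [set l | has_derivative f X (X *m Emx R i j) l].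

Definition stein_op (R : realType) (N : nat) (p : SO R N -> R) (i j : 'I_N)
    (h : SO R N -> R) (X : SO R N) : R :=
  Dfield i j h X + h X * Dfield i j (fun Y => ln (p Y)) X.

Definition stein_kernel (R : realType) (N : nat) (k : SO R N -> SO R N -> R)
    (p : SO R N -> R) (X Y : SO R N) : R :=
  \sum_(i < N) \sum_(j < N | (i < j)%N)
    stein_op p i j (fun Y' => stein_op p i j (fun X' => k X' Y') X) Y.

Definition exp_kernel (R : realType) (N : nat) (tau : R) (X Y : SO R N) : R :=
  expR (tau * \tr (X^T *m Y)).

Definition wKSD2 (R : realType) (N n : nat) (k : SO R N -> SO R N -> R)
    (p q w : SO R N -> R) (X : 'I_n -> SO R N) : R :=
  (n%:R ^+ 2)^-1 * \sum_(i < n) \sum_(j < n)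
    stein_kernel k p (X i) (X j) * q (X i) * q (X j)
      * (w (X i))^-1 * (w (X j))^-1.

Definition KSD2 (R : realType) (N n : nat) (k : SO R N -> SO R N -> R)
    (p : SO R N -> R) (X : 'I_n -> SO R N) : R :=
  (n%:R ^+ 2)^-1 * \sum_(i < n) \sum_(j < n) stein_kernel k p (X i) (X j).

Definition skew_part (R : realType) (N : nat) (B : 'M[R]_N) : 'M[R]_N :=
  2^-1 *: (B - B^T).

(* Column stacking: entry (r, c) of B has (0-based) position c * N + r.  The
   library's mxvec stacks rows. *)
Definition vec (R : realType) (N : nat) (B : 'M[R]_N) : 'cV[R]_(N * N) :=
  \col_a B (mxtens_unindex a).2 (mxtens_unindex a).1.

(* Indices are 0-based. *)
Definition perfect_shuffle (R : realType) (N : nat) : 'M[R]_(N * N) :=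
  \matrix_(a, b) [exists k : 'I_N, exists l : 'I_N,
    (a == N * k + l :> nat)%N && (b == N * l + k :> nat)%N]%:R.

Definition Zmx (R : realType) (N m : nat) (gzeta : 'I_m -> SO R N -> 'M[R]_N)
    (X : SO R N) : 'M[R]_(m, N * N) :=
  \matrix_(i, a) vec (gzeta i X) a 0.

Definition Mmx (R : realType) (N : nat) (X Y : SO R N) : 'M[R]_(N * N) :=
  tensmx (1%:M : 'M[R]_N) (X *m Y^T)
    - tensmx (Y^T : 'M[R]_N) X *m perfect_shuffle R N.

Definition rho_weighted (R : realType) (N n : nat) (tau : R)
    (q w : SO R N -> R) (X : 'I_n -> SO R N) (i j : 'I_n) : R :=
  exp_kernel tau (X i) (X j) * (q (X i) / w (X i)) * (q (X j) / w (X j)).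

Definition rho_unweighted (R : realType) (N n : nat) (tau : R)
    (X : 'I_n -> SO R N) (i j : 'I_n) : R :=
  exp_kernel tau (X i) (X j).

Definition Amx (R : realType) (N m n : nat)
    (gzeta : 'I_m -> SO R N -> 'M[R]_N) (X : 'I_n -> SO R N)
    (rho : 'I_n -> 'I_n -> R) : 'M[R]_m :=
  (2 * n%:R ^+ 2)^-1 *: \sum_(i < n) \sum_(j < n)
    rho i j *: (Zmx gzeta (X i) *m Mmx (X i) (X j) *m (Zmx gzeta (X j))^T).

Definition bvec (R : realType) (N m n : nat) (tau : R)
    (gzeta : 'I_m -> SO R N -> 'M[R]_N) (geta : SO R N -> 'M[R]_N)
    (X : 'I_n -> SO R N) (rho : 'I_n -> 'I_n -> R) : 'cV[R]_m :=
  ((2 * n%:R ^+ 2)^-1 *: (\sum_(i < n) \sum_(j < n)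
     rho i j *: ((vec (geta (X i)))^T *m Mmx (X i) (X j)
                   *m (Zmx gzeta (X j))^T))
   + (tau / n%:R ^+ 2) *: (\sum_(i < n) \sum_(j < n)
     rho i j *: ((vec (X i *m skew_part ((X j)^T *m X i)))^T
                   *m (Zmx gzeta (X i))^T)))^T.

Definition is_the_global_minimizer (R : realType) (m : nat)
    (f : 'cV[R]_m -> R) (t : 'cV[R]_m) :=
  (forall s, f t <= f s) /\ (forall s, (forall u, f s <= f u) -> s = t).

(* Main.v *)
Require Import Defs.
From HB Require Import structures.
From mathcomp Require Import all_boot all_order all_algebra.
From mathcomp Require Import all_classical all_reals all_analysis.
From mathcomp Require Import ring lra.

Set Implicit Arguments.
Unset Strict Implicit.
Unset Printing Implicit Defensive.

Import Order.TTheory GRing.Theory Num.Theory numFieldNormedType.Exports.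

Local Open Scope classical_set_scope.
Local Open Scope ring_scope.

(** Along the field E_ij, the logarithmic derivative of p_theta at X is the
    coordinate on E_ij of X^T G_theta(X), where
    G_theta = sum_k theta_k grad zeta_k + grad eta is affine in theta; the
    normalizing constant disappears under the logarithm.  Differentiating the
    kernel k = exp (tau tr (X^T Y)) once in each variable gives
<<
      k_p(X, Y) = k(X, Y) *
        (<tau X^T Y + X^T G(X), tau Y^T X + Y^T G(Y)> + r(X, Y)),
>>
    where <U, V> is the Frobenius product of the skew parts of U and V
    (skew_dot) and r does not involve p: this is stein_kernel_exp.  The sum over
    i < j becomes <., .> because the E_ij are an orthonormal basis of the skew
    matrices (sum_Emx).

    Hence the discrepancy is a quadratic polynomial in theta.  Its quadratic and
    linear parts are theta^T A theta and 2 b^T theta, because the matrix M_ij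
    represents 2 <X_i^T ., X_j^T .> in column-stacked coordinates (Mmx_form);
    the two kernel cross terms in the linear part, and the two terms that
    pair eta with zeta, coincide after exchanging i and j, rho being symmetric.

    The quadratic part is nonnegative since exp (tau <X, Y>) is a positive
    semidefinite kernel: its Taylor coefficients are nonnegative, and powers of
    an inner product are positive semidefinite (exp_kernel_skew_psd).  A
    quadratic polynomial with a positive semidefinite invertible A has
    - A^-1 b as its only minimizer (quadratic_minimizer).

    The analytic point is that the operators D^ij are defined through
    derivatives along all curves in SO(N) with a prescribed velocity.  Such a
    derivative is only determined if a curve exists; the plane rotations provide
    one in each direction X E_ij (exists_curve). *)

(** * Entrywise derivatives of matrix curves *)

(** Matrices carry the maximum norm, so that differentiability can be checked
    on the entries; all matrix calculus below is reduced to this. *)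
Lemma is_derive_mx (R : realType) (m n : nat) (M : R -> 'M[R]_(m, n)) (t : R)
    (D : 'M[R]_(m, n)) :
  is_derive t 1 M D <-> forall i j, is_derive t 1 (fun s => M s i j) (D i j).
Proof.
split=> [[dM DM] i j|h].
- apply: DeriveDef; first by have [+ _] := derivable_mxP M t 1; exact.
  by rewrite -DM derive_mx// mxE.
- have dM : derivable M t 1.
    by apply/derivable_mxP => i j; have [] := h i j.
  apply: DeriveDef => //; rewrite derive_mx//; apply/matrixP => i j.
  by rewrite mxE; have [] := h i j.
Qed.

Lemma is_derive_mulmx (R : realType) (m n k : nat) (B : 'M[R]_(m, n))
    (M : R -> 'M[R]_(n, k)) (t : R) (D : 'M[R]_(n, k)) :
  is_derive t 1 M D -> is_derive t 1 (fun s => B *m M s) (B *m D).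
Proof.
move=> /is_derive_mx hM; apply/is_derive_mx => i j.
rewrite (_ : (fun s => _) =
    \sum_(l < n) (B i l \*: (fun s => M s l j))); last first.
  by apply/funext => s; rewrite mxE fct_sumE; apply: eq_bigr.
by rewrite mxE; apply: is_derive_sum => l; exact: is_deriveZ.
Qed.

Lemma is_derive_mxtrace (R : realType) (n : nat) (M : R -> 'M[R]_n) (t : R)
    (D : 'M[R]_n) :
  is_derive t 1 M D -> is_derive t 1 (fun s => \tr (M s)) (\tr D).
Proof.
move=> /is_derive_mx hM.
rewrite (_ : (fun s => _) = \sum_(l < n) (fun s => M s l l)); last first.
  by apply/funext => s; rewrite fct_sumE.
exact: is_derive_sum.
Qed.

(** * Rotations in coordinate planes, and curves in SO(N) *)

Definition plane_mx (R : realType) (N : nat) (i j : 'I_N) : 'M[R]_N :=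
  delta_mx i j - delta_mx j i.

Lemma plane_mxT (R : realType) (N : nat) (i j : 'I_N) :
  (plane_mx R i j)^T = - plane_mx R i j.
Proof. by rewrite /plane_mx linearB/= !trmx_delta opprB. Qed.

(** J^3 = - J is the relation that makes exp (a J) collapse to Rodrigues'
    formula 1 + sin a J + (1 - cos a) J^2. *)
Lemma plane_mx_cube (R : realType) (N : nat) (i j : 'I_N) : i != j ->
  plane_mx R i j *m plane_mx R i j *m plane_mx R i j = - plane_mx R i j.
Proof.
move=> ij; have ji : j != i by rewrite eq_sym.
have J2 : plane_mx R i j *m plane_mx R i j = - (delta_mx i i + delta_mx j j).
  rewrite /plane_mx mulmxBl !mulmxBr !mul_delta_mx_cond !eqxx (negbTE ij).
  by rewrite (negbTE ji) sub0r subr0 opprD.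
rewrite J2 mulNmx; congr (- _); rewrite /plane_mx mulmxBr !mulmxDl.
rewrite !mul_delta_mx_cond !eqxx (negbTE ij) (negbTE ji).
by rewrite !mulr0n addr0 add0r.
Qed.

Definition rotation (R : realType) (N : nat) (i j : 'I_N) (a : R) : 'M[R]_N :=
  1%:M + sin a *: plane_mx R i j
    + (1 - cos a) *: (plane_mx R i j *m plane_mx R i j).

Lemma rotationD (R : realType) (N : nat) (i j : 'I_N) (a b : R) : i != j ->
  rotation i j a *m rotation i j b = rotation i j (a + b).
Proof.
move=> ij; rewrite /rotation sinD cosD.
have := plane_mx_cube R ij; move: (plane_mx R i j) => J J3.
have J4 : J *m J *m (J *m J) = - (J *m J) by rewrite mulmxA J3 mulNmx.
have J3' : J *m (J *m J) = - J by rewrite mulmxA.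
rewrite !(mulmxDl, mulmxDr, mul1mx, mulmx1) -!(scalemxAl, scalemxAr).
rewrite J3 J4 J3' !scalerN !scalerA.
move: (sin a) (cos a) (sin b) (cos b) => s c s' c'.
apply/matrixP => x y; rewrite !mxE; ring.
Qed.

(** Orthogonality only gives a determinant of square 1; it equals 1 because a
    rotation is the square of the rotation by half the angle. *)
Lemma rotation_SO (R : realType) (N : nat) (i j : 'I_N) (a : R) : i != j ->
  SO_set R N (rotation i j a).
Proof.
move=> ij; have orth (b : R) : (rotation i j b)^T *m rotation i j b = 1%:M.
  have -> : (rotation i j b)^T = rotation i j (- b).
    rewrite /rotation sinN cosN; have := plane_mxT R i j.
    move: (plane_mx R i j) => J JT.
    rewrite !linearD !linearZ/= trmx1 trmx_mul JT.
    by rewrite mulmxN mulNmx opprK scalerN scaleNr.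
  by rewrite rotationD// addNr /rotation sin0 cos0 subrr !scale0r !addr0.
split=> //; rewrite [a]splitr -rotationD// det_mulmx.
by rewrite -{1}det_tr -det_mulmx orth det1.
Qed.

Lemma is_derive_rotation (R : realType) (N : nat) (i j : 'I_N) (c : R) :
  is_derive (0 : R) 1 (fun t => rotation i j (c * t)) (c *: plane_mx R i j).
Proof.
apply/is_derive_mx => k l.
have dc : is_derive (0 : R) 1 (fun t => c * t) c.
  by apply: is_derive_eq; rewrite /= [c *: _]mulr1.
have ds : is_derive (0 : R) 1 (sin \o (fun t => c * t)) c.
  by apply: is_derive_eq; rewrite /= mulr0 cos0 mul1r.
have dcos : is_derive (0 : R) 1 (cos \o (fun t => c * t)) 0.
  by apply: is_derive_eq; rewrite /= mulr0 sin0 oppr0 mul0r.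
rewrite (_ : (fun s => _) = cst ((1%:M : 'M[R]_N) k l)
   + (plane_mx R i j k l \*: (sin \o (fun t => c * t)))
   + ((plane_mx R i j *m plane_mx R i j) k l
        \*: (cst 1 - (cos \o (fun t => c * t))))).
  apply: is_derive_eq; rewrite subr0 scaler0 addr0 add0r.
  by rewrite [in RHS]mxE mulrC.
apply/funext => s; rewrite /rotation mxE [in LHS]mxE ![in LHS](mxE scalemx_key).
rewrite -![((_ + _) : R -> R) s]/(_ s + _ s) /=.
by congr (_ + _ + _); rewrite mulrC.
Qed.

Lemma SO_setM (R : realType) (N : nat) (X Y : 'M[R]_N) :
  SO_set R N X -> SO_set R N Y -> SO_set R N (X *m Y).
Proof.
move=> [oX dX] [oY dY]; split; last by rewrite det_mulmx dX dY mulr1.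
by rewrite trmx_mul mulmxA -(mulmxA _ X^T) oX mulmx1.
Qed.

(** The curve t |-> X exp (t E_ij), written with a plane rotation since E_ij is
    sqrt 2 / 2 times the generator plane_mx i j. *)
Lemma exists_curve (R : realType) (N : nat) (X : SO R N) (i j : 'I_N) :
  i != j -> exists g, curve_through X (X *m Emx R i j) g.
Proof.
move=> ij; pose c : R := Num.sqrt 2 / 2.
pose g (t : R) : SO R N :=
  SigSub (mem_set (SO_setM (set_valP X) (rotation_SO (c * t) ij))).
exists g; split.
  apply: val_inj => /=; rewrite mulr0 /rotation sin0 cos0 subrr !scale0r !addr0.
  by rewrite mulmx1.
apply: (is_derive_mulmx (X : 'M[R]_N)).
exact: is_derive_rotation.
Qed.

(** The existence of one curve through X with velocity X E_ij makes the
    derivative unique, so the choice in Dfield returns it. *)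
Lemma DfieldE (R : realType) (N : nat) (i j : 'I_N) (f : SO R N -> R)
    (X : SO R N) (l : R) : i != j ->
  has_derivative f X (X *m Emx R i j) l -> Dfield i j f X = l.
Proof.
move=> ij fl; apply: xget_unique => // l' fl'.
have [g gX] := exists_curve X ij.
by rewrite -(derive_val (is_derive := fl g gX))
  -(derive_val (is_derive := fl' g gX)).
Qed.

(** * The inner product of skew parts *)

(** The Frobenius inner product of the orthogonal projections onto the skew
    matrices, the Lie algebra of SO(N). *)
Definition skew_dot (R : realType) (N : nat) (U V : 'M[R]_N) : R :=
  \tr ((skew_part U)^T *m skew_part V).

Lemma skew_partD (R : realType) (N : nat) (U V : 'M[R]_N) :
  skew_part (U + V) = skew_part U + skew_part V.
Proof.
by rewrite /skew_part [(U + V)^T]linearD/= opprD addrACA scalerDr.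
Qed.

Lemma skew_partZ (R : realType) (N : nat) (a : R) (U : 'M[R]_N) :
  skew_part (a *: U) = a *: skew_part U.
Proof.
by rewrite /skew_part [(a *: U)^T]linearZ/= -scalerBr !scalerA mulrC.
Qed.

Lemma skew_part_tr (R : realType) (N : nat) (U : 'M[R]_N) :
  (skew_part U)^T = - skew_part U.
Proof.
by rewrite /skew_part linearZ/= linearB/= trmxK -[in RHS]scalerN opprB.
Qed.

Lemma skew_dotDl (R : realType) (N : nat) (U V W : 'M[R]_N) :
  skew_dot (U + V) W = skew_dot U W + skew_dot V W.
Proof. by rewrite /skew_dot skew_partD linearD/= mulmxDl linearD. Qed.

Lemma skew_dotZl (R : realType) (N : nat) (a : R) (U V : 'M[R]_N) :
  skew_dot (a *: U) V = a * skew_dot U V.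
Proof.
by rewrite /skew_dot skew_partZ [(a *: _)^T]linearZ/= -scalemxAl mxtraceZ.
Qed.

Lemma skew_dotC (R : realType) (N : nat) (U V : 'M[R]_N) :
  skew_dot U V = skew_dot V U.
Proof. by rewrite /skew_dot -mxtrace_tr trmx_mul trmxK. Qed.

Lemma skew_dotDr (R : realType) (N : nat) (U V W : 'M[R]_N) :
  skew_dot W (U + V) = skew_dot W U + skew_dot W V.
Proof. by rewrite skew_dotC skew_dotDl !(skew_dotC _ W). Qed.

Lemma skew_dotZr (R : realType) (N : nat) (a : R) (U V : 'M[R]_N) :
  skew_dot V (a *: U) = a * skew_dot V U.
Proof. by rewrite skew_dotC skew_dotZl skew_dotC. Qed.

Lemma mxtrace_trmulE (R : realType) (n : nat) (U V : 'M[R]_n) :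
  \tr (U^T *m V) = \sum_i \sum_j U i j * V i j.
Proof.
rewrite exchange_big; apply: eq_bigr => j _ /=.
by rewrite mxE; apply: eq_bigr => i _; rewrite mxE.
Qed.

Lemma skew_dotE (R : realType) (N : nat) (U V : 'M[R]_N) :
  skew_dot U V = 2^-1 * (\tr (U^T *m V) - \tr (U^T *m V^T)).
Proof.
rewrite /skew_dot skew_part_tr /skew_part mulNmx -scalemxAl -scalemxAr.
rewrite mulmxBl !mulmxBr !linearN/= !mxtraceZ !linearB/=.
have -> : \tr (U *m V) = \tr (U^T *m V^T).
  by rewrite -mxtrace_tr trmx_mul mxtrace_mulC.
have -> : \tr (U *m V^T) = \tr (U^T *m V).
  by rewrite -mxtrace_tr trmx_mul trmxK mxtrace_mulC.
by field.
Qed.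

(** One projection suffices in skew_dot, as skew and symmetric matrices are
    orthogonal. *)
Lemma skew_dot_trace (R : realType) (N : nat) (U V : 'M[R]_N) :
  skew_dot U V = \tr ((skew_part U)^T *m V).
Proof.
rewrite /skew_dot skew_part_tr !mulNmx !linearN/=; congr (- _).
rewrite {2}/skew_part -scalemxAr mxtraceZ mulmxBr linearB/=.
have -> : \tr (skew_part U *m V^T) = - \tr (skew_part U *m V).
  rewrite -mxtrace_tr trmx_mul trmxK skew_part_tr.
  by rewrite mulmxN linearN/= mxtrace_mulC.
by field.
Qed.

Lemma sum_strict_upper (R : realType) (N : nat) (F : 'I_N -> 'I_N -> R) :
  (forall i j, F i j = F j i) -> (forall i, F i i = 0) ->
  \sum_(i < N) \sum_(j < N | (i < j)%N) F i j
    = 2^-1 * \sum_(i < N) \sum_(j < N) F i j.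
Proof.
move=> FC F0.
have -> : \sum_(i < N) \sum_(j < N) F i j =
    \sum_(i < N) \sum_(j < N | (i < j)%N) F i j +
    \sum_(i < N) \sum_(j < N | (j < i)%N) F i j.
  rewrite -big_split/=; apply: eq_bigr => i _.
  rewrite (bigID (fun j : 'I_N => (i < j)%N))/=; congr (_ + _).
  rewrite (bigID (fun j : 'I_N => j == i))/= [X in X + _]big1 ?add0r.
    by apply: eq_bigl => j; rewrite -leqNgt ltn_neqAle andbC.
  by move=> j /andP[_ /eqP->].
have -> : \sum_(i < N) \sum_(j < N | (j < i)%N) F i j
    = \sum_(i < N) \sum_(j < N | (i < j)%N) F i j.
  rewrite (exchange_big_dep xpredT)//=; apply: eq_bigr => i _.
  by apply: eq_bigr.
by field.
Qed.

Lemma Emx_coord (R : realType) (N : nat) (i j : 'I_N) (U : 'M[R]_N) :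
  \tr ((Emx R i j)^T *m U) = Num.sqrt 2 / 2 * (U i j - U j i).
Proof.
rewrite /Emx linearZ/= linearB/= !trmx_delta -scalemxAl mxtraceZ.
congr (_ * _); rewrite mulmxBl linearB/=.
have tr k l : \tr (delta_mx k l *m U) = U l k.
  rewrite -(mul_delta_mx (0 : 'I_1)) -mulmxA mxtrace_mulC -rowE -colE.
  by rewrite trace_mx11 !mxE.
by rewrite !tr.
Qed.

(** Parseval's identity: the factor sqrt 2 / 2 makes the E_ij an orthonormal
    basis of the skew matrices. *)
Lemma sum_Emx (R : realType) (N : nat) (U V : 'M[R]_N) :
  \sum_(i < N) \sum_(j < N | (i < j)%N)
     \tr ((Emx R i j)^T *m U) * \tr ((Emx R i j)^T *m V) = skew_dot U V.
Proof.
have s2 : (Num.sqrt 2 / 2) * (Num.sqrt 2 / 2) = 2^-1 :> R.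
  by rewrite mulrACA -expr2 sqr_sqrtr//; field.
under eq_bigr do under eq_bigr do rewrite !Emx_coord mulrACA s2.
rewrite sum_strict_upper; first last.
- by move=> i; rewrite subrr mul0r mulr0.
- by move=> i j; ring.
rewrite /skew_dot mxtrace_trmulE mulr_sumr; apply: eq_bigr => i _.
rewrite mulr_sumr; apply: eq_bigr => j _; rewrite !mxE; ring.
Qed.

(** * Column stacking, Kronecker products and the perfect shuffle *)

(** The shuffle exchanges the two digits k and l of the index N * k + l. *)
Lemma perfect_shuffleE (R : realType) (N : nat) (k l : 'I_N) (b : 'I_(N * N)) :
  perfect_shuffle R N (mxtens_index (k, l)) b = (b == mxtens_index (l, k))%:R.
Proof.
rewrite mxE; congr (_%:R); congr nat_of_bool; apply/existsP/eqP => [|->].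
  move=> [k' /existsP[l' /andP[/eqP a' /eqP b']]].
  have e : mxtens_index (k, l) = mxtens_index (k', l').
    by apply: val_inj; rewrite [LHS]a' /= mulnC.
  have [-> ->] := can_inj (@mxtens_indexK N N) e.
  by apply: val_inj; rewrite [LHS]b' /= mulnC.
by exists k; apply/existsP; exists l; rewrite /= !(mulnC N) !eqxx.
Qed.

Lemma vec_index (R : realType) (N : nat) (H : 'M[R]_N) (c r : 'I_N) :
  vec H (mxtens_index (c, r)) 0 = H r c.
Proof. by rewrite mxE mxtens_indexK. Qed.

Lemma sum_mxtens (R : realType) (m n : nat) (F : 'I_(m * n) -> R) :
  \sum_a F a = \sum_i \sum_j F (mxtens_index (i, j)).
Proof.
rewrite pair_big/= (reindex (@mxtens_index m n))/=; last first.
  exists (@mxtens_unindex m n) => i _;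
    by rewrite ?mxtens_indexK ?mxtens_unindexK.
by apply: eq_bigr => -[i j].
Qed.

Lemma vec_dot (R : realType) (N : nat) (G H : 'M[R]_N) :
  ((vec G)^T *m vec H) 0 0 = \tr (G^T *m H).
Proof.
rewrite mxE sum_mxtens; apply: eq_bigr => c _; rewrite mxE.
 apply: eq_bigr => r _.
by rewrite mxE !vec_index mxE.
Qed.

Lemma vecB (R : realType) (N : nat) (G H : 'M[R]_N) :
  vec (G - H) = vec G - vec H.
Proof. by apply/matrixP => a b; rewrite !mxE. Qed.

Lemma perfect_shuffle_vec (R : realType) (N : nat) (H : 'M[R]_N) :
  perfect_shuffle R N *m vec H = vec H^T.
Proof.
apply/matrixP => a z; rewrite (ord1 z); case: (mxtens_indexP a) => c r.
rewrite vec_index mxE (bigD1 (mxtens_index (r, c)))//=.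
rewrite perfect_shuffleE eqxx mul1r.
rewrite vec_index mxE big1 ?addr0// => b /negbTE nb.
by rewrite perfect_shuffleE nb mul0r.
Qed.

Lemma tensmx_vec (R : realType) (N : nat) (A B H : 'M[R]_N) :
  tensmx A B *m vec H = vec (B *m H *m A^T).
Proof.
apply/matrixP => a z; rewrite (ord1 z); case: (mxtens_indexP a) => c r.
rewrite vec_index mxE sum_mxtens mxE; apply: eq_bigr => c' _.
rewrite !mxE mulr_suml; apply: eq_bigr => r' _.
by rewrite tensmxE vec_index; ring.
Qed.

(** The term 1 (x) X Y^T produces tr ((X^T G)^T (Y^T H)) and the
    shuffled term produces tr ((X^T G)^T (Y^T H)^T); their difference is
    twice the product of the skew parts by skew_dotE. *)
Lemma Mmx_form (R : realType) (N : nat) (X Y : SO R N) (G H : 'M[R]_N) :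
  ((vec G)^T *m Mmx X Y *m vec H) 0 0
    = 2 * skew_dot ((X : 'M[R]_N)^T *m G) ((Y : 'M[R]_N)^T *m H).
Proof.
rewrite skew_dotE /Mmx -mulmxA mulmxBl -mulmxA perfect_shuffle_vec !tensmx_vec.
rewrite trmx1 mulmx1 trmxK -vecB vec_dot mulrA divff ?pnatr_eq0// mul1r.
by rewrite mulmxBr linearB/= !trmx_mul !trmxK !mulmxA.
Qed.

(** * Positive semidefiniteness of the kernel *)

(** Schur's product theorem for the powers of a Gram matrix: splitting off one
    factor <v_i, v_j> = sum_a v_i(a) v_j(a) turns the form with weights c_i into
    a sum over a of forms of lower degree with weights c_i v_i(a). *)
Lemma dot_power_psd (R : realType) (n d : nat) (v : 'I_n -> 'I_d -> R) (r : nat)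
    (c : 'I_n -> R) :
  0 <= \sum_(i < n) \sum_(j < n)
         (\sum_(a < d) v i a * v j a) ^+ r * (c i * c j).
Proof.
elim: r c => [|r IH] c.
  under eq_bigr do under eq_bigr do rewrite expr0 mul1r.
  under eq_bigr do rewrite -mulr_sumr.
  by rewrite -mulr_suml -expr2 sqr_ge0.
have -> : \sum_(i < n) \sum_(j < n)
         (\sum_(a < d) v i a * v j a) ^+ r.+1 * (c i * c j) =
   \sum_(a < d) \sum_(i < n) \sum_(j < n)
     (\sum_(a < d) v i a * v j a) ^+ r * ((c i * v i a) * (c j * v j a)).
  rewrite [RHS]exchange_big/=; apply: eq_bigr => i _.
  rewrite [RHS]exchange_big/=; apply: eq_bigr => j _.
  rewrite exprSr -mulrA mulr_suml mulr_sumr; apply: eq_bigr => a _.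
  by congr (_ * _); ring.
by apply: sumr_ge0 => a _; exact: IH.
Qed.

(** The partial sums of the exponential series are combinations of powers with
    nonnegative coefficients, and nonnegativity passes to the limit. *)
Lemma dot_exp_psd (R : realType) (n d : nat) (v : 'I_n -> 'I_d -> R) (tau : R)
    (c : 'I_n -> R) : 0 <= tau ->
  0 <= \sum_(i < n) \sum_(j < n)
         expR (tau * \sum_(a < d) v i a * v j a) * (c i * c j).
Proof.
move=> tau0; pose z i j := tau * \sum_(a < d) v i a * v j a.
pose S m :=
  \sum_(i < n) \sum_(j < n) series (exp_coeff (z i j)) m * (c i * c j).
have S_ge0 m : 0 <= S m.
  have -> : S m = \sum_(0 <= r < m) (tau ^+ r / r`!%:R) *
      \sum_(i < n) \sum_(j < n)
         (\sum_(a < d) v i a * v j a) ^+ r * (c i * c j).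
    under [RHS]eq_bigr do rewrite mulr_sumr.
    rewrite [RHS]exchange_big/=; apply: eq_bigr => i _.
    under [RHS]eq_bigr do rewrite mulr_sumr.
    rewrite [RHS]exchange_big/=; apply: eq_bigr => j _.
    rewrite /series/= mulr_suml; apply: eq_bigr => r _.
    by rewrite /exp_coeff/= /z exprMn; ring.
  apply: sumr_ge0 => r _; apply: mulr_ge0; last exact: dot_power_psd.
  by rewrite divr_ge0// exprn_ge0.
have S_cvg : S m @[m --> \oo] -->
    \sum_(i < n) \sum_(j < n) expR (z i j) * (c i * c j).
  apply: cvg_big => [|i _]; first exact: add_continuous.
  apply: cvg_big => [|j _]; first exact: add_continuous.
  by apply: cvgMr_tmp; exact: is_cvg_series_exp_coeff.
rewrite -(cvg_lim _ S_cvg)//; apply: limr_ge.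
  by apply/cvg_ex; eexists; exact: S_cvg.
exact: nearW.
Qed.

Lemma exp_kernel_psd (R : realType) (N n : nat) (tau : R) (x : 'I_n -> SO R N)
    (c : 'I_n -> R) : 0 <= tau ->
  0 <= \sum_(i < n) \sum_(j < n) exp_kernel tau (x i) (x j) * (c i * c j).
Proof.
move=> tau0.
have := dot_exp_psd (fun i (a : 'I_(N * N)) => vec (x i) a 0) c tau0.
move/le_trans; apply; rewrite le_eqVlt; apply/orP; left; apply/eqP.
apply: eq_bigr => i _; apply: eq_bigr => j _.
rewrite /exp_kernel -vec_dot mxE; congr (expR (_ * _) * _).
by apply: eq_bigr => a _; rewrite [(vec (x i))^T 0 a]mxE.
Qed.

(** Each entry of the skew parts contributes a scalar form with its own
    weights. *)
Lemma exp_kernel_skew_psd (R : realType) (N n : nat) (tau : R)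
    (x : 'I_n -> SO R N) (c : 'I_n -> R) (V : 'I_n -> 'M[R]_N) : 0 <= tau ->
  0 <= \sum_(i < n) \sum_(j < n)
         exp_kernel tau (x i) (x j) * (c i * c j) * skew_dot (V i) (V j).
Proof.
move=> tau0; have -> : \sum_(i < n) \sum_(j < n)
    exp_kernel tau (x i) (x j) * (c i * c j) * skew_dot (V i) (V j) =
  \sum_(k < N) \sum_(l < N) \sum_(i < n) \sum_(j < n)
    exp_kernel tau (x i) (x j) *
      ((c i * skew_part (V i) k l) * (c j * skew_part (V j) k l)).
  under [RHS]eq_bigr do rewrite exchange_big/=.
  rewrite [RHS]exchange_big/=; apply: eq_bigr => i _.
  under [RHS]eq_bigr do rewrite exchange_big/=.
  rewrite [RHS]exchange_big/=; apply: eq_bigr => j _.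
  rewrite /skew_dot mxtrace_trmulE mulr_sumr; apply: eq_bigr => k _.
  by rewrite mulr_sumr; apply: eq_bigr => l _; ring.
by apply: sumr_ge0 => k _; apply: sumr_ge0 => l _; exact: exp_kernel_psd.
Qed.

(** * Minimizing a positive semidefinite quadratic polynomial *)

(** The condition on A is only semidefiniteness, so uniqueness is obtained from
    stationarity: a minimizer s satisfies A s + b = 0, and A is injective. *)
Lemma quadratic_minimizer (R : realType) (m : nat) (A : 'M[R]_m) (b : 'cV[R]_m)
    (f : 'cV[R]_m -> R) (c0 : R) :
  (forall u v : 'cV[R]_m, (u^T *m A *m v) 0 0 = (v^T *m A *m u) 0 0) ->
  (forall u : 'cV[R]_m, 0 <= (u^T *m A *m u) 0 0) ->
  (forall t, f t = (t^T *m A *m t) 0 0 + 2 * (b^T *m t) 0 0 + c0) ->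
  A \in unitmx -> is_the_global_minimizer f (- (invmx A *m b)).
Proof.
move=> AC A0 fE uA.
have fD t h : f (t + h) = f t + 2 * (h^T *m (A *m t + b)) 0 0
    + (h^T *m A *m h) 0 0.
  have D (M1 M2 : 'M[R]_1) : (M1 + M2) 0 0 = M1 0 0 + M2 0 0 by rewrite mxE.
  have bh : (b^T *m h) 0 0 = (h^T *m b) 0 0.
    by rewrite -[b^T *m h]trmxK mxE trmx_mul trmxK.
  have TD : (t + h)^T = t^T + h^T by rewrite linearD.
  rewrite !fE TD !(mulmxDl, mulmxDr) !D (AC t h) bh !mulmxA; ring.
set t := - (invmx A *m b).
have At : A *m t + b = 0.
  by rewrite /t mulmxN mulmxA mulmxV// mul1mx addNr.
split=> [s|s smin].
  rewrite -[s](subrK t) addrC fD At mulmx0 mxE mulr0 addr0 lerDl; exact: A0.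
pose g := A *m s + b.
have gg : (g^T *m g) 0 0 = \sum_i g i 0 ^+ 2.
  by rewrite mxE; apply: eq_bigr => i _; rewrite mxE expr2.
have gg0 : (g^T *m g) 0 0 = 0.
  set y := (g^T *m g) 0 0; set a := (g^T *m A *m g) 0 0.
  have a0 : 0 <= a by exact: A0.
  (* Along s - e g the increment of f is e^2 a - 2 e y; for this step size,
     y = e (1 + a), it equals - e^2 (2 + a), which must not be negative. *)
  pose e := y / (1 + a).
  have ye : y = e * (1 + a) by rewrite /e divfK// gt_eqF// ltr_wpDr.
  have := smin (s + (- e) *: g).
  have Z (k : R) (M : 'M[R]_1) : (k *: M) 0 0 = k * M 0 0 by rewrite mxE.
  rewrite fD -addrA lerDl [((- e) *: g)^T]linearZ/= -/g.
  rewrite -!(scalemxAl, scalemxAr).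
  rewrite !Z -/y -/a => h.
  have e2 : e ^+ 2 = 0.
    apply: le_anti; rewrite sqr_ge0 andbT.
    have : e ^+ 2 * (2 + a) <= 0 by rewrite ye in h; nra.
    by rewrite pmulr_lle0// ltr_wpDr.
  by rewrite ye; move/eqP: e2; rewrite sqrf_eq0 => /eqP->; rewrite mul0r.
have g0 : g = 0.
  apply/matrixP => i z; rewrite (ord1 z) [RHS]mxE; apply/eqP; rewrite -sqrf_eq0.
  move: gg0; rewrite gg => /eqP.
  rewrite psumr_eq0; last by move=> k _; exact: sqr_ge0.
  by move/allP => /(_ i); rewrite mem_index_enum => /(_ isT).
apply: (can_inj (mulKmx uA)); apply: (addIr b); rewrite At; exact: g0.
Qed.

(** * The Stein kernel of the exponential kernel *)

Lemma Emx_tr (R : realType) (N : nat) (i j : 'I_N) :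
  (Emx R i j)^T = - Emx R i j.
Proof. by rewrite /Emx [LHS]linearZ/= (plane_mxT R i j) scalerN. Qed.

Lemma tangent_Emx (R : realType) (N : nat) (X : SO R N) (i j : 'I_N) :
  tangent X (X *m Emx R i j).
Proof. by exists (Emx R i j) => //=; exact: Emx_tr. Qed.

Lemma exp_kernelC (R : realType) (N : nat) (tau : R) (X Y : SO R N) :
  exp_kernel tau X Y = exp_kernel tau Y X.
Proof. by rewrite /exp_kernel -mxtrace_tr trmx_mul trmxK. Qed.

Lemma is_derive_trace_curve (R : realType) (N : nat) (B D : 'M[R]_N)
    (Y : SO R N) (g : R -> SO R N) : curve_through Y D g ->
  is_derive (0 : R) 1 (fun t => \tr (B *m g t)) (\tr (B *m D)).
Proof. by move=> [_ dg]; apply: is_derive_mxtrace; exact: is_derive_mulmx. Qed.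

Lemma exp_kernel_derivative (R : realType) (N : nat) (tau : R) (X Y : SO R N)
    (D : 'M[R]_N) :
  has_derivative (exp_kernel tau X) Y D
    (exp_kernel tau X Y * (tau * \tr ((X : 'M[R]_N)^T *m D))).
Proof.
move=> g gY; have d := is_derive_trace_curve (X : 'M[R]_N)^T gY.
have dz := is_deriveZ tau d.
have := is_derive1_comp (is_derive_expR _) dz.
by rewrite /= gY.1.
Qed.

Lemma Dfield_log (R : realType) (N : nat)
    (p : SO R N -> R) (G : SO R N -> 'M[R]_N)
    (i j : 'I_N) (X : SO R N) :
  (forall Z, is_gradient (fun Y => ln (p Y)) Z (G Z)) -> i != j ->
  Dfield i j (fun Y => ln (p Y)) X
    = \tr ((Emx R i j)^T *m ((X : 'M[R]_N)^T *m G X)).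
Proof.
move=> Gp ij; rewrite mulmxA -trmx_mul; apply: DfieldE => //.
by apply: Gp; exact: tangent_Emx.
Qed.

(** The first application multiplies the kernel by the coordinate on E_ij of
    tau X^T Y + X^T G(X). *)
Lemma stein_op_exp_kernel (R : realType) (N : nat) (tau : R)
    (p : SO R N -> R) (G : SO R N -> 'M[R]_N)
    (i j : 'I_N) (X Y : SO R N) :
  (forall Z, is_gradient (fun Y => ln (p Y)) Z (G Z)) -> i != j ->
  stein_op p i j (fun X' => exp_kernel tau X' Y) X =
  exp_kernel tau X Y * \tr ((Emx R i j)^T *m
     (tau *: ((X : 'M[R]_N)^T *m Y) + (X : 'M[R]_N)^T *m G X)).
Proof.
move=> Gp ij; rewrite /stein_op (Dfield_log X Gp)//.
rewrite mulmxDr -scalemxAr linearD/= mxtraceZ.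
rewrite mulrDr; congr (_ + _); rewrite mulmxA -trmx_mul.
rewrite (_ : (fun X' : SO R N => _) = exp_kernel tau Y); last first.
  by apply/funext => X'; exact: exp_kernelC.
rewrite exp_kernelC -[\tr (_^T *m _)]mxtrace_tr trmx_mul trmxK.
by apply: DfieldE => //; exact: exp_kernel_derivative.
Qed.

(** The factor produced by the first application depends on Y through
    tau X^T Y, and the product rule creates the last term from it; that term
    is free of G. *)
Lemma stein_op2_exp_kernel (R : realType) (N : nat) (tau : R)
    (p : SO R N -> R) (G : SO R N -> 'M[R]_N)
    (i j : 'I_N) (X Y : SO R N) :
  (forall Z, is_gradient (fun Y => ln (p Y)) Z (G Z)) -> i != j ->
  let E := Emx R i j in
  stein_op p i j
    (fun Y' => stein_op p i j (fun X' => exp_kernel tau X' Y') X) Y =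
  exp_kernel tau X Y *
   (\tr (E^T *m (tau *: ((X : 'M[R]_N)^T *m Y) + (X : 'M[R]_N)^T *m G X)) *
    \tr (E^T *m (tau *: ((Y : 'M[R]_N)^T *m X) + (Y : 'M[R]_N)^T *m G Y)) +
    tau * \tr (E^T *m (X : 'M[R]_N)^T *m (Y *m E))).
Proof.
move=> Gp ij E.
have trD (B M : 'M[R]_N) :
    \tr (E^T *m (tau *: B + M)) = tau * \tr (E^T *m B) + \tr (E^T *m M).
  by rewrite mulmxDr -scalemxAr mxtraceD mxtraceZ.
have -> : (fun Y' => stein_op p i j (fun X' => exp_kernel tau X' Y') X) =
  (fun Y' => exp_kernel tau X Y' *
    (tau * \tr (E^T *m (X : 'M[R]_N)^T *m Y') +
      \tr (E^T *m ((X : 'M[R]_N)^T *m G X)))).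
  apply/funext => Y'; rewrite (stein_op_exp_kernel _ _ _ Gp)//.
  by rewrite trD !mulmxA.
rewrite {1}/stein_op (Dfield_log Y Gp)// !trD.
set s := \tr (E^T *m (X^T *m G X)).
set s' := \tr (E^T *m (Y^T *m G Y)).
have := @DfieldE R N i j (fun Y' => exp_kernel tau X Y' *
    (tau * \tr (E^T *m (X : 'M[R]_N)^T *m Y') + s)) Y
  (exp_kernel tau X Y * (tau * \tr (E^T *m (X : 'M[R]_N)^T *m (Y *m E))) +
   (tau * \tr (E^T *m (X : 'M[R]_N)^T *m Y) + s) *
   (exp_kernel tau X Y * (tau * \tr ((X : 'M[R]_N)^T *m (Y *m E))))) ij.
move=> ->.
  have -> : \tr (E^T *m (Y^T *m X)) = \tr (X^T *m (Y *m E)).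
    by rewrite -[LHS]mxtrace_tr !trmx_mul !trmxK mulmxA.
  by rewrite !mulmxA; ring.
move=> g gY.
have d1 := exp_kernel_derivative tau X gY.
have d2 := is_derive_trace_curve (E^T *m (X : 'M[R]_N)^T) gY.
have d3 := is_deriveZ tau d2.
have d4 := is_deriveD d3 (is_derive_cst s (0 : R) 1).
apply: (is_derive_eq (is_deriveM d1 d4)).
by rewrite -![((_ + _) : R -> R) 0]/(_ 0 + _ 0) /= gY.1 addr0.
Qed.

(** Summing over the E_ij turns products of coordinates into skew_dot.  The
    last sum does not involve p, hence is constant along the exponential
    family. *)
Lemma stein_kernel_exp (R : realType) (N : nat) (tau : R)
    (p : SO R N -> R) (G : SO R N -> 'M[R]_N)
    (X Y : SO R N) :
  (forall Z, is_gradient (fun Y => ln (p Y)) Z (G Z)) ->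
  stein_kernel (exp_kernel tau) p X Y =
  exp_kernel tau X Y *
   (skew_dot (tau *: ((X : 'M[R]_N)^T *m Y) + (X : 'M[R]_N)^T *m G X)
             (tau *: ((Y : 'M[R]_N)^T *m X) + (Y : 'M[R]_N)^T *m G Y) +
    \sum_(i < N) \sum_(j < N | (i < j)%N)
      tau * \tr ((Emx R i j)^T *m (X : 'M[R]_N)^T *m (Y *m Emx R i j))).
Proof.
move=> Gp; rewrite -sum_Emx -big_split/= mulr_sumr; apply: eq_bigr => i _.
rewrite -big_split/= mulr_sumr; apply: eq_bigr => j ij.
by rewrite (stein_op2_exp_kernel _ _ _ Gp)// -val_eqE ltn_eqF.
Qed.

(** * The discrepancy as a quadratic polynomial in theta *)

(** The part of the gradient of log p_theta that is linear in theta. *)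
Definition lin_grad (R : realType) (N m : nat)
    (gzeta : 'I_m -> SO R N -> 'M[R]_N)
    (theta : 'cV[R]_m) (X : SO R N) : 'M[R]_N :=
  \sum_k theta k 0 *: gzeta k X.

Lemma vec_lin_grad (R : realType) (N m : nat)
    (gzeta : 'I_m -> SO R N -> 'M[R]_N) (theta : 'cV[R]_m) (X : SO R N) :
  vec (lin_grad gzeta theta X) = (Zmx gzeta X)^T *m theta.
Proof.
apply/matrixP => a z; rewrite (ord1 z) !mxE summxE; apply: eq_bigr => k _.
by rewrite !mxE mulrC.
Qed.

(** The unknown normalizing constant becomes an additive constant of the
    logarithm. *)
Lemma exp_family_gradient (R : realType) (N m : nat)
    (zeta : SO R N -> 'cV[R]_m) (eta p : SO R N -> R)
    (gzeta : 'I_m -> SO R N -> 'M[R]_N) (geta : SO R N -> 'M[R]_N)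
    (theta : 'cV[R]_m) (c : R) (X : SO R N) :
  (forall k, is_gradient (fun Y => zeta Y k 0) X (gzeta k X)) ->
  is_gradient eta X (geta X) -> 0 < c ->
  (forall Y, p Y = c * expR ((theta^T *m zeta Y) 0 0 + eta Y)) ->
  is_gradient (fun Y => ln (p Y)) X (lin_grad gzeta theta X + geta X).
Proof.
move=> dz de c0 pE D tD g gX.
have -> : (fun t => ln (p (g t))) =
   cst (ln c) + (\sum_(k < m) (theta k 0 \*: (fun t => zeta (g t) k 0))
     + (fun t => eta (g t))).
  apply/funext => t; rewrite pE lnM ?posrE ?expR_gt0// expRK.
  rewrite -![((_ + _) : R -> R) t]/(_ t + _ t) fct_sumE mxE/=.
  by congr (_ + (_ + _)); apply: eq_bigr => k _; rewrite mxE.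
have dk k := is_deriveZ (theta k 0) (dz k D tD g gX).
have ds := is_derive_sum dk.
have := is_deriveD (is_derive_cst (ln c) (0 : R) 1)
  (is_deriveD ds (de D tD g gX)).
rewrite add0r; congr is_derive.
rewrite mulmxDr linearD/= mulmx_sumr linear_sum/=; congr (_ + _).
by apply: eq_bigr => k _; rewrite -scalemxAr mxtraceZ.
Qed.

Lemma double_sum_form (R : realType) (m1 m2 n : nat) (rho : 'I_n -> 'I_n -> R)
    (F : 'I_n -> 'I_n -> 'M[R]_(m1, m2)) (u : 'cV[R]_m1) (v : 'cV[R]_m2) :
  (u^T *m (\sum_(i < n) \sum_(j < n) rho i j *: F i j) *m v) 0 0 =
  \sum_(i < n) \sum_(j < n) rho i j * (u^T *m F i j *m v) 0 0.
Proof.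
rewrite mulmx_sumr mulmx_suml summxE; apply: eq_bigr => i _.
rewrite mulmx_sumr mulmx_suml summxE; apply: eq_bigr => j _.
by rewrite -scalemxAr -scalemxAl mxE.
Qed.

Lemma sum_swap_sym (R : realType) (n : nat) (rho F : 'I_n -> 'I_n -> R) :
  (forall i j, rho i j = rho j i) ->
  \sum_(i < n) \sum_(j < n) rho i j * F i j
    = \sum_(i < n) \sum_(j < n) rho i j * F j i.
Proof.
move=> rhoC; rewrite exchange_big; apply: eq_bigr => i _.
by apply: eq_bigr => j _; rewrite rhoC.
Qed.

Lemma Amx_form (R : realType) (N m n : nat)
    (gzeta : 'I_m -> SO R N -> 'M[R]_N) (x : 'I_n -> SO R N)
    (rho : 'I_n -> 'I_n -> R) (u v : 'cV[R]_m) :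
  let lin (t : 'cV[R]_m) i := (x i : 'M[R]_N)^T *m lin_grad gzeta t (x i) in
  (u^T *m Amx gzeta x rho *m v) 0 0 = (n%:R ^+ 2)^-1 *
    \sum_(i < n) \sum_(j < n) rho i j * skew_dot (lin u i) (lin v j).
Proof.
move=> lin; rewrite /Amx -scalemxAr -scalemxAl mxE double_sum_form.
rewrite invfM mulrC mulrA mulrC.
congr (_ * _); rewrite mulr_suml; apply: eq_bigr => i _.
rewrite mulr_suml; apply: eq_bigr => j _.
rewrite -mulrA; congr (_ * _).
have -> :
    u^T *m (Zmx gzeta (x i) *m Mmx (x i) (x j) *m (Zmx gzeta (x j))^T) *m v
    = (vec (lin_grad gzeta u (x i)))^T *m Mmx (x i) (x j)
        *m vec (lin_grad gzeta v (x j)).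
  by rewrite !vec_lin_grad trmx_mul trmxK !mulmxA.
by rewrite Mmx_form mulrC mulrA mulVf ?mul1r// pnatr_eq0.
Qed.

Lemma bvec_form (R : realType) (N m n : nat) (tau : R)
    (gzeta : 'I_m -> SO R N -> 'M[R]_N) (geta : SO R N -> 'M[R]_N)
    (x : 'I_n -> SO R N) (rho : 'I_n -> 'I_n -> R) (v : 'cV[R]_m) :
  let lin (t : 'cV[R]_m) i := (x i : 'M[R]_N)^T *m lin_grad gzeta t (x i) in
  let base i := (x i : 'M[R]_N)^T *m geta (x i) in
  let rel i j := (x i : 'M[R]_N)^T *m x j in
  ((bvec tau gzeta geta x rho)^T *m v) 0 0 = (n%:R ^+ 2)^-1 *
    (\sum_(i < n) \sum_(j < n) rho i j * skew_dot (base i) (lin v j)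
     + tau * \sum_(i < n) \sum_(j < n) rho i j * skew_dot (rel j i) (lin v i)).
Proof.
move=> lin base rel; have dsum1 (F : 'I_n -> 'I_n -> 'rV[R]_m) :
    ((\sum_(i < n) \sum_(j < n) rho i j *: F i j) *m v) 0 0 =
    \sum_(i < n) \sum_(j < n) rho i j * (F i j *m v) 0 0.
  have := double_sum_form rho F 1%:M v; rewrite trmx1 mul1mx => ->.
  by apply: eq_bigr => i _; apply: eq_bigr => j _; rewrite mul1mx.
rewrite /bvec trmxK mulmxDl mxE -!scalemxAl mxE [X in _ + X]mxE !dsum1.
rewrite mulrDr; congr (_ + _).
  rewrite invfM mulrC mulrA mulrC; congr (_ * _).
  rewrite mulr_suml; apply: eq_bigr => i _.
  rewrite mulr_suml; apply: eq_bigr => j _; rewrite -mulrA; congr (_ * _).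
  rewrite -mulmxA -vec_lin_grad Mmx_form mulrC mulrA mulVf ?pnatr_eq0//.
  exact: mul1r.
rewrite (mulrC tau) -mulrA; congr (_ * (_ * _)).
apply: eq_bigr => i _; apply: eq_bigr => j _; congr (_ * _).
rewrite -mulmxA -vec_lin_grad vec_dot skew_dot_trace trmx_mul.
by rewrite mulmxA.
Qed.

(** Both the weighted and the unweighted discrepancy have this form, with
    c_i = q(X_i) / w(X_i) and c_i = 1 respectively.  The c_i are absorbed into
    the weights of the positive semidefinite form. *)
Lemma weighted_minimizer (R : realType) (N m n : nat) (tau : R)
    (tau0 : 0 <= tau)
    (p : 'cV[R]_m -> SO R N -> R)
    (gzeta : 'I_m -> SO R N -> 'M[R]_N) (geta : SO R N -> 'M[R]_N)
    (x : 'I_n -> SO R N) (c : 'I_n -> R) :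
  (forall theta X, is_gradient (fun Y => ln (p theta Y)) X
     (lin_grad gzeta theta X + geta X)) ->
  let rho i j := exp_kernel tau (x i) (x j) * (c i * c j) in
  Amx gzeta x rho \in unitmx ->
  is_the_global_minimizer
    (fun theta => (n%:R ^+ 2)^-1 * \sum_(i < n) \sum_(j < n)
       c i * c j * stein_kernel (exp_kernel tau) (p theta) (x i) (x j))
    (- (invmx (Amx gzeta x rho) *m bvec tau gzeta geta x rho)).
Proof.
move=> pG rho uA.
have rhoC i j : rho i j = rho j i by rewrite /rho exp_kernelC (mulrC (c i)).
pose lin (u : 'cV[R]_m) i := (x i : 'M[R]_N)^T *m lin_grad gzeta u (x i).
pose base i := (x i : 'M[R]_N)^T *m geta (x i).
pose rel i j := (x i : 'M[R]_N)^T *m x j.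
pose rest i j := \sum_(k < N) \sum_(l < N | (k < l)%N)
   tau * \tr ((Emx R k l)^T *m (x i : 'M[R]_N)^T *m (x j *m Emx R k l)).
pose cst i j := skew_dot (tau *: rel i j + base i) (tau *: rel j i + base j)
   + rest i j.
apply: (quadratic_minimizer (c0 := (n%:R ^+ 2)^-1 *
  \sum_(i < n) \sum_(j < n) rho i j * cst i j)) => //.
- move=> u v; rewrite !Amx_form (sum_swap_sym _ rhoC); congr (_ * _).
  by apply: eq_bigr => i _; apply: eq_bigr => j _; rewrite skew_dotC.
- move=> u; rewrite Amx_form mulr_ge0 ?invr_ge0 ?sqr_ge0//.
  exact: exp_kernel_skew_psd.
move=> t; rewrite Amx_form bvec_form -/lin -/base -/rel.
have -> : \sum_(i < n) \sum_(j < n)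
    c i * c j * stein_kernel (exp_kernel tau) (p t) (x i) (x j) =
  \sum_(i < n) \sum_(j < n) rho i j * skew_dot (lin t i) (lin t j)
  + (\sum_(i < n) \sum_(j < n) rho i j * skew_dot (base i) (lin t j)
   + \sum_(i < n) \sum_(j < n) rho i j * skew_dot (base j) (lin t i))
  + tau * (\sum_(i < n) \sum_(j < n) rho i j * skew_dot (rel i j) (lin t j)
     + \sum_(i < n) \sum_(j < n) rho i j * skew_dot (rel j i) (lin t i))
  + \sum_(i < n) \sum_(j < n) rho i j * cst i j.
  rewrite -!big_split mulr_sumr -!big_split/=; apply: eq_bigr => i _.
  rewrite -!big_split mulr_sumr -!big_split/=; apply: eq_bigr => j _.
  rewrite (stein_kernel_exp _ _ _ (pG t)) !mulmxDr.
  rewrite -/(lin t i) -/(lin t j) -/(base i) -/(base j) -/(rel i j) -/(rel j i).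
  rewrite -/(rest i j) /cst /rho.
  rewrite !(skew_dotDl, skew_dotDr, skew_dotZl, skew_dotZr).
  rewrite (skew_dotC (lin t i) (base j)) (skew_dotC (lin t i) (rel j i)).
  ring.
(* The two halves of each mixed term agree after exchanging i and j. *)
rewrite (sum_swap_sym (fun i j => skew_dot (base j) (lin t i)) rhoC).
rewrite (sum_swap_sym (fun i j => skew_dot (rel i j) (lin t j)) rhoC).
ring.
Qed.

Theorem theorem10 (R : realType) (N m n : nat) (hN : (0 < N)%N) (hn : (0 < n)%N)
    (mu : probability (SO R N) R) (hmu : is_haar mu)
    (d : measure_display) (T : measurableType d) (P : probability T R)
    (q : SO R N -> R) (hq : is_density mu q)
    (zeta : SO R N -> 'cV[R]_m) (eta : SO R N -> R)
    (hzeta : forall i : 'I_m,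
       continuously_differentiable (fun X => zeta X i 0))
    (heta : continuously_differentiable eta)
    (p : 'cV[R]_m -> SO R N -> R)
    (hpd : forall theta, is_density mu (p theta))
    (hp : forall theta, exists2 c : R, 0 < c & forall X : SO R N,
       p theta X = c * expR ((theta^T *m zeta X) 0 0 + eta X))
    (gzeta : 'I_m -> SO R N -> 'M[R]_N) (geta : SO R N -> 'M[R]_N)
    (hgzeta : forall (i : 'I_m) (X : SO R N),
       is_gradient (fun Y => zeta Y i 0) X (gzeta i X))
    (hgeta : forall X : SO R N, is_gradient eta X (geta X))
    (tau : R) (htau : 0 < tau) :
  (forall w : SO R N -> R, is_density mu w -> (forall X, 0 < w X) ->
   forall X : 'I_n -> {RV P >-> SO R N}, samples_from mu w X ->
   forall omega : T,
     let x := fun i => X i omega in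
     let rho := rho_weighted tau q w x in
     let A := Amx gzeta x rho in
     let b := bvec tau gzeta geta x rho in
     A \in unitmx ->
     is_the_global_minimizer
       (fun theta => wKSD2 (exp_kernel tau) (p theta) q w x)
       (- (invmx A *m b))) /\
  (forall X : 'I_n -> {RV P >-> SO R N}, samples_from mu q X ->
   forall omega : T,
     let x := fun i => X i omega in
     let rho := rho_unweighted tau x in
     let A := Amx gzeta x rho in
     let b := bvec tau gzeta geta x rho in
     A \in unitmx ->
     is_the_global_minimizer
       (fun theta => KSD2 (exp_kernel tau) (p theta) x)
       (- (invmx A *m b))).
Proof.
have dlogp theta X : is_gradient (fun Y => ln (p theta Y)) X
    (lin_grad gzeta theta X + geta X).
  have [c c0 pE] := hp theta.
  by apply: (exp_family_gradient _ _ c0 pE).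
split=> [w _ _ X _ omega x rho A b uA|X _ omega x rho A b uA].
- pose c i := q (x i) / w (x i).
  have rhoE : rho = fun i j => exp_kernel tau (x i) (x j) * (c i * c j).
    by apply/funext => i; apply/funext => j; rewrite /rho /rho_weighted -mulrA.
  rewrite (_ : (fun theta => _) = fun theta => (n%:R ^+ 2)^-1 *
      \sum_(i < n) \sum_(j < n)
       c i * c j * stein_kernel (exp_kernel tau) (p theta) (x i) (x j)).
    move: uA; rewrite /A /b rhoE; apply: weighted_minimizer => //; exact: ltW.
  apply/funext => theta; congr (_ * _); apply: eq_bigr => i _.
  by apply: eq_bigr => j _; rewrite /c; ring.
- have rhoE : rho = fun i j => exp_kernel tau (x i) (x j) * (1 * 1).
    by apply/funext => i; apply/funext => j; rewrite !mulr1.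
  rewrite (_ : (fun theta => _) = fun theta => (n%:R ^+ 2)^-1 *
      \sum_(i < n) \sum_(j < n)
       1 * 1 * stein_kernel (exp_kernel tau) (p theta) (x i) (x j)).
    move: uA; rewrite /A /b rhoE.
    exact: (weighted_minimizer (ltW htau) (c := fun=> 1) (dlogp)).
  apply/funext => theta; congr (_ * _); apply: eq_bigr => i _.
  by apply: eq_bigr => j _; rewrite !mul1r.
Qed.
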